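(* Let $m$ be an odd integer such that $m$ has three or more prime factors and $D = 9m^2+4m$ is square-free, and let $K=\mathbb{Q}(\sqrt{D})$ with class number $h_K$. Let $\mathcal{N}$ be the number of distinct prime divisors of $m$ that are greater than $3$. Then $$h_K \geq \begin{cases} 1+\mathcal{N} & \text{if } m \equiv 2 \pmod 3,\\ 2+\mathcal{N} & \text{otherwise.}\end{cases}$$
   Context: $K=\mathbb{Q}(\sqrt{D})$ is a real quadratic field; $h_K$ denotes the order of its (ordinary) ideal class group. *)

(* Defs.v *)
From HB Require Import structures.
From mathcomp Require Import all_boot all_order all_algebra all_field.
From mathcomp Require Import finmap.
From mathcomp Require Import boolp classical_sets functions cardinality.

Set Implicit Arguments.
Unset Strict Implicit.
Unset Printing Implicit Defensive.

Import Order.TTheory GRing.Theory Num.Theory.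

Local Open Scope classical_set_scope.
Local Open Scope ring_scope.

Definition squarefree (n : int) : Prop :=
  forall d : int, (d ^+ 2 %| n)%Z -> `|d| = 1.

(* For square-free D, the condition D != 1 makes 'X^2 - D irreducible over rat,
   so that K is then a quadratic field; it is real when 0 < D. *)
Definition is_quadratic_field (D : int) (K : fieldExtType rat) : Prop :=
  [/\ squarefree D, D != 1 &
      exists2 s : K, s ^+ 2 = D%:~R & <<1; s>>%VS = {:K}%VS].

Definition is_real_quadratic_field (D : int) (K : fieldExtType rat) : Prop :=
  0 < D /\ is_quadratic_field D K.

Section ClassGroup.

Variable K : fieldExtType rat.

Definition ring_of_integers : set K :=
  [set x | integralOver (intr : int -> K) x].

Definition fractional_ideal (I : set K) : Prop :=
  [/\ exists2 x, I x & x != 0,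
      forall x y, I x -> I y -> I (x + y),
      forall a x, ring_of_integers a -> I x -> I (a * x) &
      exists2 d, ring_of_integers d /\ d != 0 &
        forall x, I x -> ring_of_integers (d * x)].

(* The coset of I modulo the principal fractional ideals: the product of I by
   the principal fractional ideal generated by c is {c * x | x in I}. *)
Definition ideal_class (I : set K) : set (set K) :=
  [set J | exists2 c : K, c != 0 & J = [set c * x | x in I]].

(* Only the underlying set of the class group is needed for its order. *)
Definition class_group : set (set (set K)) :=
  [set ideal_class I | I in fractional_ideal].

(* [fset_set A] is empty when A is infinite, so a positive lower bound on
   [class_number] includes the finiteness of the class group. *)
Definition class_number : nat := #|` fset_set class_group|.

End ClassGroup.

(* Main.v *)
(* With k = (D - 1) / 4 and w = (1 + sqrt D) / 2, the ring of integers is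
   Z + Z w.  The unit ((9m + 2) + 3 sqrt D) / 2 is small: multiplying by its inverse
   shrinks the w-coordinate of any element whose norm is less than |m| in
   absolute value, so such a norm is, up to sign, a perfect square.  Each prime
   p | m ramifies, and 3 splits when m = 1 mod 3; let P_p be a prime above such
   a p, and P_1 the unit ideal.  If P_p and P_q were in the same class, there
   would be an element of norm +-pq, which is not a square; but pq < |m|, as m
   has three prime factors.  Finiteness of the class group is Hurwitz's
   argument: after multiplication by some t <= D, every element of K is at
   distance of norm less than 1 from an integer, so that, for F = D!, each class
   has a representative between F O_K and O_K. *)
Require Import Defs.
From mathcomp Require Import all_boot all_order all_algebra all_field.
From mathcomp Require Import boolp classical_sets cardinality.
From mathcomp Require Import zify ring lra.

Set Implicit Arguments.
Unset Strict Implicit.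
Unset Printing Implicit Defensive.

Import Order.TTheory GRing.Theory Num.Theory.
Local Open Scope ring_scope.

(** * Small norms *)

(* The hypothesis on [h] says that [h + 3 - 3 * w] is a unit of norm 1, where
   [w ^+ 2 = w + k]; multiplication by it is the descent step on [`|v|]. *)
Lemma small_norm_square (h k u v n : int) : 0 < h ->
  h ^+ 2 + 3 * h - 9 * k = 1 ->
  u ^+ 2 + u * v - k * v ^+ 2 = n -> 9 * `|n| < 2 * h + 1 ->
  exists r : nat, `|n|%N = (r ^ 2)%N.
Proof.
move=> h_gt0 hk.
have [b] := ubnP `|v|%N; elim: b u v => // b IHb u v.
wlog v_ge0 : u v / 0 <= v.
  move=> W lev nuv; have [v_ge0|/ltW v_le0] := lerP 0 v; first exact: W lev nuv.
  by apply: (W (- u) (- v)); [lia|lia|rewrite -nuv; ring].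
(* Negated conjugation keeps [v] and the norm, and changes the sign of the trace [2 * u + v]. *)
wlog a_ge0 : u / 0 <= 2 * u + v.
  move=> W lev nuv; have [a_ge0|/ltW a_le0] := lerP 0 (2 * u + v); first exact: W nuv.
  by apply: (W (- (u + v))); [lia|lia|rewrite -nuv; ring].
move=> lev nuv small_n; have [v0|v_neq0] := eqVneq v 0.
  exists `|u|%N; rewrite -nuv v0; lia.
have [lt1|ge1] := ltrP `|h * v - 3 * u| `|v|.
  apply: (IHb ((h + 3) * u - 3 * k * v) (h * v - 3 * u)) => //; first by lia.
  rewrite -nuv.
  have -> : ((h + 3) * u - 3 * k * v) ^+ 2 +
      ((h + 3) * u - 3 * k * v) * (h * v - 3 * u) - k * (h * v - 3 * u) ^+ 2 =
      (h ^+ 2 + 3 * h - 9 * k) * (u ^+ 2 + u * v - k * v ^+ 2) by ring.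
  by rewrite hk mul1r.
(* The descent step does not decrease [`|v|]: squaring bounds [3 * a], where
   [a ^+ 2 = (4 * k + 1) * v ^+ 2 + 4 * n], contradicts [small_n]. *)
exfalso; pose t := 2 * h + 3; pose a := 2 * u + v.
have t_gt : 4 < t by rewrite /t; lia.
have aE : 9 * a ^+ 2 = (t ^+ 2 - 4) * v ^+ 2 + 36 * n.
  rewrite -nuv /a /t; have -> : (2 * h + 3) ^+ 2 - 4 = 9 + 36 * k by lia.
  by ring.
have v1 : 1 <= v ^+ 2 by rewrite -[1](expr1n _ 2) ler_sqr ?nnegrE //; lia.
have tv : t - 2 <= (t - 2) * v ^+ 2 by rewrite ler_peMr //; lia.
have n_small : 9 * `|n| < t - 2 by rewrite /t; lia.
have a0 : 0 <= a by [].
have av : `|t * v - 3 * a| >= 2 * v.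
  have -> : t * v - 3 * a = 2 * (h * v - 3 * u) by rewrite /t /a; ring.
  by rewrite normrM; lia.
clearbody t a.
have [le_a|ge_a] : 3 * a <= (t - 2) * v \/ (t + 2) * v <= 3 * a by lia.
- have : (3 * a) ^+ 2 <= ((t - 2) * v) ^+ 2 by rewrite ler_sqr ?nnegrE //; lia.
  have -> : (3 * a) ^+ 2 = 9 * a ^+ 2 by ring.
  rewrite aE; lia.
have : ((t + 2) * v) ^+ 2 <= (3 * a) ^+ 2 by rewrite ler_sqr ?nnegrE //; nia.
have -> : (3 * a) ^+ 2 = 9 * a ^+ 2 by ring.
rewrite aE; lia.
Qed.

(** The exponent of [q] in [p * q] is 1, hence odd. The value [p = 1] is allowed because the unit
    ideal is compared too. *)
Lemma nonsquare_mul_primes (p q : nat) : prime q -> (p == 1)%N || prime p -> p != q ->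
  ~ exists r : nat, (p * q)%N = (r ^ 2)%N.
Proof.
move=> q_pr p_pr neq [r rE].
have p_gt0 : (0 < p)%N by case/orP: p_pr => [/eqP->|/prime_gt0].
have : odd (logn q (p * q)) = false by rewrite rE lognX oddM.
rewrite lognM ?(prime_gt0 q_pr) // (logn_prime q q_pr) eqxx oddD.
suff -> : logn q p = 0%N by [].
case/orP: p_pr => [/eqP->|p_pr]; first by rewrite logn1.
by rewrite logn_prime // eq_sym; case: eqP neq => // ->; rewrite eqxx.
Qed.

(** * The ring of integers *)

Lemma size_monic_quadratic (R : nzRingType) (c d : R) :
  size (('X + c%:P) * 'X + d%:P) = 3%N.
Proof. by rewrite size_MXaddC (negPf (monic_neq0 (monicXaddC c))) size_XaddC. Qed.

Lemma monic_quadratic (R : nzRingType) (c d : R) :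
  ('X + c%:P) * 'X + d%:P \is monic.
Proof.
rewrite monicE /lead_coef size_monic_quadratic /=.
by rewrite coefD coefMX coefC addr0 coefD coefX coefC addr0.
Qed.

(** Gauss's lemma: [p] is [a] times an integral factor [p1] of [q]. As [q] is monic, [p1] has
    leading coefficient 1 or -1, so [a] is 1 or -1. *)
Lemma monic_dvdp_int (p : {poly rat}) (q : {poly int}) :
  p \is monic -> q \is monic -> p %| map_poly intr q ->
  forall i, p`_i \is a Num.int.
Proof.
move=> p_mon q_mon /dvdpP_rat_int[p1 [a a_neq0 pE] [r qE]] i.
have : lead_coef p1 * lead_coef r = 1.
  by rewrite -lead_coefM -qE; apply/eqP.
move=> lc1; have lcu : `|lead_coef p1| = 1.
  by move/(congr1 absz)/eqP: lc1; rewrite abszM muln_eq1 => /andP[/eqP + _]; lia.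
have lcp : a * (lead_coef p1)%:~R = 1.
  by move: p_mon; rewrite pE monicE lead_coefZ (lead_coef_map_inj intr_inj) // => /eqP.
rewrite pE coefZ coef_map /=; apply: rpredM; last exact: intr_int.
have -> : a = (lead_coef p1)%:~R.
  have [e|e] : lead_coef p1 = 1 \/ lead_coef p1 = -1 by lia.
    by rewrite -lcp e mulr1.
  by move: lcp; rewrite e => /(congr1 -%R); rewrite mulrN1 opprK => ->.
exact: intr_int.
Qed.

(** The squared denominator of [r] is coprime to the squared numerator, so it divides [d]. *)
Lemma rat_sqr_int (d : int) (r : rat) :
  squarefree d -> r ^+ 2 * d%:~R \is a Num.int -> r \is a Num.int.
Proof.
move=> d_sqf /intrP[z rz]; rewrite Qint_def; apply/eqP.
suff /d_sqf : (denq r ^+ 2 %| d)%Z by rewrite gtr0_norm ?denq_gt0.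
rewrite -(@Gauss_dvdzr _ (numq r ^+ 2)); last first.
  by rewrite coprimezXl // coprimezXr // coprimez_sym coprimezE coprime_num_den.
apply/dvdzP; exists z; apply: (@intr_inj rat).
by rewrite !rmorphM /= -rz !numqE; ring.
Qed.

(* [qnorm k u v] is the norm of [u + v * w] when [w ^+ 2 = w + k]. *)
Definition qnorm (R : comNzRingType) (k : int) (u v : R) : R :=
  u ^+ 2 + u * v - k%:~R * v ^+ 2.

Lemma qnorm_intr (k a b : int) :
  qnorm k (a%:~R : rat) b%:~R = (qnorm k a b)%:~R.
Proof. by rewrite /qnorm rmorphB rmorphD !rmorphM /= intz; ring. Qed.

Lemma qnormM (R : comNzRingType) (k : int) (u v u' v' : R) :
  qnorm k (u * u' + k%:~R * (v * v')) (u * v' + u' * v + v * v') =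
  qnorm k u v * qnorm k u' v'.
Proof. by rewrite /qnorm; ring. Qed.

(** * Diophantine approximation and small norms *)

(** Pigeonhole: the fractional parts of the [M.+2] multiples [i * y], from [i = 0] on, fall into
    [M.+1] boxes of equal length. *)
Lemma dirichlet_approximation (M : nat) (y : rat) :
  exists2 t : nat, (0 < t <= M.+1)%N &
    exists b : int, M.+1%:R * `|t%:R * y - b%:~R| < 1.
Proof.
pose frac (i : nat) : rat := i%:R * y - (Num.floor (i%:R * y))%:~R.
have frac_itv i : 0 <= frac i < 1.
  by have := floor_itv (i%:R * y); rewrite /frac rmorphD /=; lra.
pose box (i : nat) := Num.floor (M.+1%:R * frac i).
have M_gt0 : 0 < M.+1%:R :> rat by [].
have box_itv i : 0 <= box i < M.+1%:Z.
  have /andP[f0 f1] := frac_itv i; apply/andP; split.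
    by rewrite floor_ge0 mulr_ge0 // ltW.
  rewrite -(ltr_int rat); apply: le_lt_trans (floor_le _) _.
  by rewrite -[ltRHS]mulr1 ltr_pM2l.
pose f (i : 'I_M.+2) : 'I_M.+1 := inord `|box i|.
case: (boolP (injectiveb f)) => [/injectiveP/leq_card|/injectivePn[i [j]]].
  by rewrite !card_ord ltnn.
wlog lt_ij : i j / (i < j)%N.
  move=> W neq_ij fij; case: (ltngtP i j) => [lt|lt|eq].
  - exact: W neq_ij fij.
  - by apply: W lt _ (esym fij); rewrite eq_sym.
  by move: neq_ij; rewrite (ord_inj eq) eqxx.
move=> _ fij; have eq_box : box i = box j.
  have := congr1 val fij; rewrite /f /= !inordK;
    by have := box_itv i; have := box_itv j; lia.
exists (j - i)%N; first by have := ltn_ord j; lia.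
exists (Num.floor (j%:R * y) - Num.floor (i%:R * y)).
have -> : (j - i)%:R * y - (Num.floor (j%:R * y) - Num.floor (i%:R * y))%:~R
    = frac j - frac i.
  by rewrite /frac natrB 1?ltnW // rmorphB /=; ring.
rewrite -[X in X * _]gtr0_norm // -normrM mulrBr ltr_norml.
have := floor_itv (M.+1%:R * frac i); have := floor_itv (M.+1%:R * frac j).
by rewrite -/(box i) -/(box j) eq_box rmorphD /=; lra.
Qed.

(** With [D = 4 * k + 1], the norm is [(X + Y / 2) ^+ 2 - D * Y ^+ 2 / 4]. Dirichlet's [t] makes
    [D * Y] at most 1 in absolute value, and rounding does the same for [X + Y / 2] with bound
    [1 / 2], so both terms lie between 0 and [1 / 4]. *)
Lemma small_qnorm_multiple (k : int) (M : nat) (x y : rat) :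
  0 < 4 * k + 1 <= M.+1%:Z ->
  exists2 t : nat, (0 < t <= M.+1)%N &
    exists a b : int, `|qnorm k (t%:R * x - a%:~R) (t%:R * y - b%:~R)| < 1.
Proof.
move=> /andP[D_gt0 D_le]; have [t t_itv [b yb]] := dirichlet_approximation M y.
exists t => //; set Y := _ - _ in yb.
pose z := t%:R * x + Y / 2 + 1 / 2; exists (Num.floor z), b.
rewrite -/Y; set X := _ - _.
have X_itv : - (1 / 2) <= X + Y / 2 <= 1 / 2.
  have zE : z = t%:R * x + Y / 2 + 1 / 2 by [].
  by have := floor_itv z; rewrite /X rmorphD /=; move: (Num.floor z)%:~R => r; lra.
have -> : qnorm k X Y = (X + Y / 2) ^+ 2 - (4 * k + 1)%:~R * Y ^+ 2 / 4.
  by rewrite /qnorm rmorphD rmorphM /=; field.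
have X2 : 0 <= (X + Y / 2) ^+ 2 <= 1 / 4.
  move: X_itv; move: (X + Y / 2) => s; rewrite -ler_norml => s_le.
  rewrite sqr_ge0 /= -(real_normK (num_real s)).
  have -> : 1 / 4 = (1 / 2) ^+ 2 :> rat by [].
  by rewrite ler_sqr ?nnegrE.
set D : rat := (4 * k + 1)%:~R.
have D0 : 0 < D by rewrite ltr0z.
have DM : D <= M.+1%:R by rewrite -[leRHS]/(M.+1%:Z%:~R) ler_int.
have M1 : 1 <= M.+1%:R :> rat by rewrite ler1n.
have Y1 : `|Y| <= 1 by apply: le_trans (ltW yb); rewrite ler_peMl.
have Y2 : Y ^+ 2 = `|Y| ^+ 2 by rewrite real_normK ?num_real.
have DY : 0 <= D * Y ^+ 2 <= 1.
  rewrite Y2; have := normr_ge0 Y; set Z := `|Y| in yb Y1 Y2 *.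
  move=> Z0; apply/andP; split; first by rewrite mulr_ge0 // ?sqr_ge0 // ltW.
  have : D * Z <= 1 by apply: le_trans (ltW yb); rewrite ler_wpM2r.
  by move=> DZ; rewrite expr2 mulrA mulr_ile1 // mulr_ge0 // ltW.
rewrite ltr_norml.
by move: X2 DY; rewrite -[_ * Y ^+ 2]/(D * Y ^+ 2); move: (D * _) (_ ^+ 2) => d x2; lra.
Qed.

(** * Arithmetic in the basis [1], [w] *)

Section QuadraticOrder.

Variables (K : fieldExtType rat) (k : int) (w : K).
Hypothesis w_sqr : w ^+ 2 = w + k%:~R.
Hypothesis w_span : forall x : K, exists a b : rat, x = a%:A + b%:A * w.
Hypothesis disc_sqf : squarefree (4 * k + 1).
Hypothesis disc_neq1 : 4 * k + 1 != 1.

Definition qel (u v : rat) : K := in_alg K u + in_alg K v * w.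

Lemma qelP x : exists a b : rat, x = qel a b.
Proof. exact: w_span. Qed.

Lemma qelM u v u' v' :
  qel u v * qel u' v' = qel (u * u' + k%:~R * (v * v')) (u * v' + u' * v + v * v').
Proof.
rewrite /qel !(rmorphD, rmorphM) rmorph_int.
have -> : forall a b c d : K, (a + b * w) * (c + d * w) =
  a * c + (a * d + c * b) * w + b * d * w ^+ 2 by move=> a b c d; ring.
by rewrite w_sqr; ring.
Qed.

Lemma qelD u v u' v' : qel u v + qel u' v' = qel (u + u') (v + v').
Proof. by rewrite /qel !rmorphD; ring. Qed.

Lemma qelB u v u' v' : qel u v - qel u' v' = qel (u - u') (v - v').
Proof. by rewrite /qel !rmorphB; ring. Qed.

Lemma qel_rat u : qel u 0 = in_alg K u.
Proof. by rewrite /qel rmorph0 mul0r addr0. Qed.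

Lemma qel_int (z : int) : qel z%:~R 0 = z%:~R.
Proof. by rewrite qel_rat rmorph_int. Qed.

(** Otherwise [w] is a rational [r] and [4 * k + 1] is the square of [2 * r - 1], which is then an
    integer; a square-free square is 1, which is excluded. *)
Lemma qel_eq0 u v : qel u v = 0 -> u = 0 /\ v = 0.
Proof.
move=> uv0; have [v0|v_neq0] := eqVneq v 0.
  by move: uv0; rewrite v0 qel_rat => /eqP; rewrite fmorph_eq0 => /eqP.
exfalso; pose r := - u / v.
have wr : w = in_alg K r.
  apply: (mulfI (_ : in_alg K v != 0)); first by rewrite fmorph_eq0.
  rewrite -rmorphM /r [v * _]mulrC divfK // rmorphN.
  by apply/eqP; rewrite -addr_eq0 addrC; apply/eqP.
have r2 : r ^+ 2 = r + k%:~R.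
  have := w_sqr; rewrite wr -(rmorph_int (in_alg K)) -rmorphXn -rmorphD.
  exact: fmorph_inj.
have D_eq : (2 * r - 1) ^+ 2 = (4 * k + 1)%:~R.
  have -> : (2 * r - 1) ^+ 2 = 4 * (r ^+ 2 - r) + 1 by ring.
  by rewrite r2 rmorphD rmorphM /=; ring.
have /intrP[z zE] : 2 * r - 1 \is a Num.int.
  apply: (@rat_sqr_int 1); last by rewrite mulr1 D_eq.
  by move=> d; rewrite dvdz1 abszX -mulnn muln_eq1 andbb => /eqP; lia.
move: D_eq; rewrite zE -rmorphXn => /intr_inj zD.
have /disc_sqf z1 : (z ^+ 2 %| 4 * k + 1)%Z by rewrite zD.
by move: disc_neq1; rewrite -zD; have [->|->] : z = 1 \/ z = -1 by lia.
Qed.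

Lemma qel_inj u v u' v' : qel u v = qel u' v' -> u = u' /\ v = v'.
Proof.
move/eqP; rewrite -subr_eq0 qelB => /eqP/qel_eq0[/eqP + /eqP].
by rewrite !subr_eq0 => /eqP-> /eqP->.
Qed.

(** The conjugate of [w] is [1 - w], so [qel (u + v) (- v)] is the conjugate of [qel u v], and their
    product is the norm. *)
Lemma qnorm_eq0 (u v : rat) : qnorm k u v = 0 -> u = 0 /\ v = 0.
Proof.
move=> n0; have : qel u v * qel (u + v) (- v) = 0.
  rewrite qelM; have -> : u * (u + v) + k%:~R * (v * - v) = 0.
    by rewrite -n0 /qnorm; ring.
  have -> : u * - v + (u + v) * v + v * - v = 0 by ring.
  by rewrite qel_rat rmorph0.
by move/eqP; rewrite mulf_eq0 => /orP[] /eqP/qel_eq0[] //; lra.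
Qed.

Lemma qel_root u v :
  qel u v ^+ 2 - in_alg K (2 * u + v) * qel u v + in_alg K (qnorm k u v) = 0.
Proof.
rewrite expr2 -!qel_rat !qelM qelB qelD.
transitivity (qel 0 0); last by rewrite qel_rat rmorph0.
by rewrite /qnorm; congr qel; ring.
Qed.

(** For nonzero [v], the trace [t] and norm [n] are integers, hence so is
    [v ^+ 2 * (4 * k + 1) = t ^+ 2 - 4 * n]. Square-freeness makes [v] an integer, and parity then
    makes [u] one. *)
Lemma integral_qel u v :
  integralOver (intr : int -> K) (qel u v) -> u \is a Num.int /\ v \is a Num.int.
Proof.
case=> q q_mon q_root.
have {}q_root : root (map_poly (in_alg K) (map_poly intr q)) (qel u v).
  rewrite -map_poly_comp; congr (root _ _) : q_root; apply: eq_map_poly => z.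
  by rewrite -[LHS](rmorph_int (in_alg K)).
have [v0|v_neq0] := eqVneq v 0.
  split; last by rewrite v0.
  have : 'X - u%:P %| map_poly intr q.
    rewrite dvdp_XsubCl; move: q_root; rewrite v0 qel_rat.
    by rewrite fmorph_root.
  move/(monic_dvdp_int (monicXsubC u) q_mon) => /(_ 0).
  by rewrite coefB coefX coefC sub0r rpredN.
(* The minimal polynomial of [qel u v] divides [q], hence is integral by Gauss. *)
pose p := ('X + (- (2 * u + v))%:P) * 'X + (qnorm k u v)%:P.
have p_mon : p \is monic by exact: monic_quadratic.
have p_root : (map_poly (in_alg K) p).[qel u v] = 0.
  rewrite /p rmorphD rmorphM rmorphD /= !map_polyX !map_polyC /= !hornerE.
  by rewrite -[RHS](qel_root u v) scaleNr !in_algE; ring.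
have : p %| map_poly intr q.
  rewrite /dvdp; set r := _ %% p.
  have size_r : (size r <= 2)%N.
    by rewrite -ltnS -(size_monic_quadratic (- (2 * u + v)) (qnorm k u v)) ltn_modp
      monic_neq0.
  have r_root : (map_poly (in_alg K) r).[qel u v] = 0.
    move: q_root; rewrite (divp_eq (map_poly intr q) p) rmorphD rmorphM /root.
    by rewrite hornerD hornerM p_root mulr0 add0r => /eqP.
  have rE : r = r`_1 *: 'X + (r`_0)%:P.
    apply/polyP => -[|[|i]]; rewrite coefD coefZ coefX coefC /=.
    - by rewrite mulr0 add0r.
    - by rewrite mulr1 addr0.
    by rewrite mulr0 addr0 nth_default // (leq_trans size_r).
  have : qel (r`_0 + r`_1 * u) (r`_1 * v) = 0.
    rewrite -r_root [in RHS]rE rmorphD /= map_polyZ map_polyX map_polyC !hornerE /qel.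
    by rewrite !(rmorphD, rmorphM); ring.
  case/qel_eq0 => r0 /eqP; rewrite mulf_eq0 (negPf v_neq0) orbF => /eqP r1.
  by rewrite rE r1 scale0r add0r polyC_eq0; move: r0; rewrite r1 mul0r addr0 => ->.
move/(monic_dvdp_int p_mon q_mon) => p_int.
have /intrP[t tE] : 2 * u + v \is a Num.int.
  by have := p_int 1; rewrite coefD coefMX coefC addr0 /= coefD coefX coefC add0r rpredN.
have /intrP[n nE] : qnorm k u v \is a Num.int.
  by have := p_int 0; rewrite coefD coefMX coefC add0r.
have vD : v ^+ 2 * (4 * k + 1)%:~R = (t ^+ 2 - 4 * n)%:~R.
  have -> : (t ^+ 2 - 4 * n)%:~R = (t%:~R ^+ 2 - 4 * n%:~R :> rat) by ring.
  by rewrite -tE -nE /qnorm; ring.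
have /intrP[b bE] : v \is a Num.int by apply: rat_sqr_int disc_sqf _; rewrite vD intr_int.
split; last by rewrite bE.
(* Modulo 4, [vD] says that [b ^+ 2] and [t ^+ 2] agree, so [t] and [b] have the same parity. *)
have [a aE] : exists a, t = 2 * a + b.
  move: vD; rewrite bE -rmorphXn -rmorphM => /intr_inj vD.
  exists ((t - b) %/ 2)%Z; have := divz_eq (t - b) 2.
  have : ((t - b) %% 2 = 0)%Z \/ ((t - b) %% 2 = 1)%Z by lia.
  by case=> e; rewrite e; nia.
suff -> : u = a%:~R by [].
move: tE; rewrite aE bE rmorphD rmorphM /=; lra.
Qed.

Lemma qel_integral (a b : int) : ring_of_integers (qel a%:~R b%:~R).
Proof.
exists (('X + (- (2 * a + b))%:P) * 'X + (qnorm k a b)%:P).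
  exact: monic_quadratic.
rewrite /root rmorphD rmorphM rmorphD /= !map_polyX !map_polyC /= !hornerE.
apply/eqP; rewrite -[RHS](qel_root a%:~R b%:~R) qnorm_intr.
have -> : 2 * a%:~R + b%:~R = (2 * a + b)%:~R :> rat by ring.
by rewrite !rmorph_int; ring.
Qed.

Lemma ring_of_integersP x :
  ring_of_integers x <-> exists a b : int, x = qel a%:~R b%:~R.
Proof.
split=> [x_int|[a [b ->]]]; last exact: qel_integral.
have [u [v xE]] := qelP x; move: x_int; rewrite xE => /integral_qel[].
by move=> /intrP[a ->] /intrP[b ->]; exists a, b.
Qed.

Local Open Scope classical_set_scope.

(** * Finiteness of the class group *)

Definition scale_set (c : K) (I : set K) : set K := [set c * x | x in I].

Lemma ideal_class_scale (c : K) (I : set K) :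
  c != 0 -> ideal_class (scale_set c I) = ideal_class I.
Proof.
move=> c_neq0; apply/seteqP; split=> J [d d_neq0 ->].
  exists (d * c); first exact: mulf_neq0.
  by rewrite /scale_set image_comp; apply: eq_imagel => x _ /=; rewrite mulrA.
exists (d / c); first by rewrite mulf_neq0 ?invr_eq0.
by rewrite /scale_set image_comp; apply: eq_imagel => x _ /=; rewrite mulrA divfK.
Qed.

Lemma ideal_class_eqP (I J : set K) :
  ideal_class I = ideal_class J -> exists2 c : K, c != 0 & J = scale_set c I.
Proof.
move=> IJ; suff : ideal_class I J by case=> c; exists c.
rewrite IJ; exists 1; first exact: oner_neq0.
by rewrite -[LHS]image_id; apply: eq_imagel => x _; rewrite mul1r.
Qed.

(** The index [A] ranges over a finite type; finiteness of the class group comes from this. *)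
Definition residue_set (n : nat) (A : {set 'I_n.+1 * 'I_n.+1}) : set K :=
  [set x | exists a b : int, x = qel a%:~R b%:~R /\
    (inord `|(a %% n.+1)%Z|, inord `|(b %% n.+1)%Z|) \in A].

(** Such a [J] contains every integral multiple of [n.+1], so membership depends only on the
    coordinates modulo [n.+1]. *)
Lemma residue_setP (J : set K) (n : nat) :
  (forall x, J x -> ring_of_integers x) ->
  (forall x y, J x -> J y -> J (x + y)) ->
  (forall a x, ring_of_integers a -> J x -> J (a * x)) ->
  J (n.+1%:Z)%:~R -> exists A : {set 'I_n.+1 * 'I_n.+1}, J = residue_set A.
Proof.
move=> J_int JD JM Jn.
have shift (a b c d : int) : J (qel a%:~R b%:~R) ->
    J (qel (a + c * n.+1)%:~R (b + d * n.+1)%:~R).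
  move=> Jab; have := JD _ _ Jab (JM _ _ (qel_integral c d) Jn).
  rewrite -qel_int qelM qelD; congr J; congr qel; ring.
pose r (a : int) : 'I_n.+1 := inord `|(a %% n.+1)%Z|.
have rE (a : int) : a = Posz (r a) + (a %/ n.+1)%Z * n.+1.
  rewrite /r inordK; first by have := divz_eq a n.+1; lia.
  by have := ltz_pmod a (isT : 0 < n.+1%:Z); have := modz_ge0 a (isT : n.+1%:Z != 0); lia.
exists (finset (fun ij : 'I_n.+1 * 'I_n.+1 =>
  `[< J (qel (Posz ij.1)%:~R (Posz ij.2)%:~R) >])).
apply/seteqP; split=> x.
  move=> Jx; have [a [b xE]] := (ring_of_integersP x).1 (J_int x Jx).
  exists a, b; split=> //; rewrite finset.inE; apply/asboolP => /=.
  rewrite xE in Jx; have := shift _ _ (- (a %/ n.+1)%Z) (- (b %/ n.+1)%Z) Jx.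
  by congr (J (qel _%:~R _%:~R)); rewrite -/(r _) [X in X + _]rE; ring.
case=> a [b [->]]; rewrite finset.inE => /asboolP /= Jab.
have := shift _ _ (a %/ n.+1)%Z (b %/ n.+1)%Z Jab.
by rewrite -!/(r _) -!rE.
Qed.

Lemma exists_min_norm (I : set K) : (exists2 x, I x & x != 0) ->
  (forall x, I x -> ring_of_integers x) ->
  exists a b : int, [/\ I (qel a%:~R b%:~R), qel a%:~R b%:~R != 0 &
    forall c d : int, I (qel c%:~R d%:~R) -> qel c%:~R d%:~R != 0 ->
      `|qnorm k a b| <= `|qnorm k c d| ].
Proof.
move=> [x Ix x_neq0] I_int.
pose P (n : nat) := exists a b : int, [/\ I (qel a%:~R b%:~R),
  qel a%:~R b%:~R != 0 & `|qnorm k a b|%N = n].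
have exP : exists n, `[< P n >].
  have [a [b xE]] := (ring_of_integersP x).1 (I_int x Ix).
  by exists `|qnorm k a b|%N; apply/asboolP; exists a, b; rewrite -xE.
case: (ex_minnP exP) => n /asboolP[a [b [Iab ab_neq0 abn]]] n_min.
exists a, b; split=> // c d Icd cd_neq0.
have /n_min : `[< P `|qnorm k c d|%N >] by apply/asboolP; exists c, d.
by rewrite -abn; lia.
Qed.

Hypothesis disc_gt0 : 0 < 4 * k + 1.

(** By [disc_gt0], [M.+1] is the discriminant [4 * k + 1]. *)
Let M := `|(4 * k)%R|%N.
Let F := (M.+1)`!.

(** Choose [x1] in [I] with [d * x1] nonzero of least absolute norm, and [c = F / x1]. For [x] in
    [I], some [t * x] minus an integral multiple of [x1] has smaller norm than [x1], hence vanishes;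
    as [t] divides [F], [c * x] is integral. *)
Lemma bounded_class_representative (I : set K) : fractional_ideal I ->
  exists2 c : K, c != 0 &
    (forall x, scale_set c I x -> ring_of_integers x) /\ scale_set c I F%:R.
Proof.
case=> [[x0 Ix0 x0_neq0] ID IM [d [_ d_neq0] dI]].
have [|x [x1 Ix1 <-]|a [b [[x1 Ix1 x1E] ab_neq0 ab_min]]] :=
    @exists_min_norm (scale_set d I).
- by exists (d * x0); [exists x0|rewrite mulf_neq0].
- exact: dI.
have x1_neq0 : x1 != 0.
  by apply: contraNneq ab_neq0 => x10; rewrite -x1E x10 mulr0.
have Fneq0 : F%:R != 0 :> K.
  by rewrite -(rmorph_nat (in_alg K)) fmorph_eq0 pnatr_eq0 -lt0n fact_gt0.
exists (F%:R / x1); first by rewrite mulf_neq0 ?invr_eq0.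
split; last by exists x1 => //; rewrite divfK.
move=> _ [x Ix <-].
have [u [v uvE]] := qelP (x / x1).
have [|t t_itv [g [h small]]] := @small_qnorm_multiple k M u v; first by rewrite /M; lia.
have t_neq0 : t%:R != 0 :> K.
  by rewrite -(rmorph_nat (in_alg K)) fmorph_eq0 pnatr_eq0; lia.
have y_eq0 : t%:R * x - qel g%:~R h%:~R * x1 = 0.
  apply/eqP/negPn/negP => y_neq0; set y := _ - _ in y_neq0.
  have Iy : I y.
    apply: ID; first by apply: IM => //; exact: integral_nat.
    rewrite -mulNr; apply: IM => //.
    have -> : - qel g%:~R h%:~R = qel (- g)%:~R (- h)%:~R.
      by rewrite /qel !rmorphN mulNr opprD.
    exact: qel_integral.
  have yE : y = qel (t%:R * u - g%:~R) (t%:R * v - h%:~R) * x1.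
    have -> : qel (t%:R * u - g%:~R) (t%:R * v - h%:~R) =
              t%:R * qel u v - qel g%:~R h%:~R.
      by rewrite /qel !rmorphB !rmorphM !rmorph_nat; ring.
    by rewrite -uvE mulrBl mulrA divfK.
  have [c [e ceE]] := (ring_of_integersP (d * y)).1 (dI y Iy).
  have ce_neq0 : qel c%:~R e%:~R != 0 by rewrite -ceE mulf_neq0.
  have le_ab : `|qnorm k a b| <= `|qnorm k c e|.
    by apply: ab_min => //; exists y.
  have : qel c%:~R e%:~R =
      qel (t%:R * u - g%:~R) (t%:R * v - h%:~R) * qel a%:~R b%:~R.
    by rewrite -ceE yE -x1E; ring.
  rewrite qelM => /qel_inj[cE eE].
  have normE : (qnorm k c e)%:~R =
      qnorm k (t%:R * u - g%:~R) (t%:R * v - h%:~R) * (qnorm k a b)%:~R.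
    by rewrite -!qnorm_intr cE eE qnormM.
  have ab_gt0 : 0 < `|qnorm k a b|%:~R :> rat.
    rewrite ltr0z normr_gt0; apply: contraNneq ab_neq0 => n0.
    have /qnorm_eq0[-> ->] : qnorm k (a%:~R : rat) b%:~R = 0.
      by rewrite qnorm_intr n0.
    by rewrite qel_rat rmorph0.
  have : `|qnorm k c e|%:~R < `|qnorm k a b|%:~R :> rat.
    by rewrite !intr_norm normE normrM -intr_norm gtr_pMl.
  by rewrite ltr_int ltNge le_ab.
have /dvdnP[q FE] : (t %| F)%N by rewrite dvdn_fact.
have -> : F%:R / x1 * x = q%:R * qel g%:~R h%:~R.
  rewrite FE natrM -mulrA -mulrA; congr (_ * _).
  move/eqP: y_eq0; rewrite subr_eq0 => /eqP txE.
  by rewrite mulrCA txE mulrC mulfK.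
by apply: integral_mul; [exact: integral_nat|exact: qel_integral].
Qed.

Lemma finite_class_group : finite_set (@class_group K).
Proof.
apply: (@sub_finite_set _ _ ((fun A : {set 'I_F.-1.+1 * 'I_F.-1.+1} =>
  ideal_class (residue_set A)) @` [set: _])); last first.
  exact/finite_image/finite_finset.
move=> _ [I I_frac <-].
have [c c_neq0 [J_int JF]] := bounded_class_representative I_frac.
case: I_frac => _ ID IM _.
have [| | |A JA] := @residue_setP (scale_set c I) F.-1 J_int.
- by move=> _ _ [x Ix <-] [y Iy <-]; exists (x + y); [exact: ID|rewrite mulrDr].
- by move=> a _ a_int [x Ix <-]; exists (a * x); [exact: IM|rewrite mulrCA].
- by rewrite prednK ?fact_gt0.
by exists A => //; rewrite -JA ideal_class_scale.
Qed.

Lemma class_number_ge (s : seq (set K)) :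
  (forall I, I \in s -> fractional_ideal I) ->
  uniq (map (@ideal_class K) s) -> (size s <= class_number K)%N.
Proof.
move=> s_frac s_uniq; rewrite /class_number -(size_map (@ideal_class K)).
apply: uniq_leq_size => // _ /mapP[I Is ->].
rewrite in_fset_set; last exact: finite_class_group.
by rewrite inE; exists I => //; exact: s_frac.
Qed.

(** * Ideals of prime norm *)

(* When [p] divides the norm [e ^+ 2 + e - k] of [e + w], this is the ideal
   generated by [p] and [e + w]. *)
Definition pideal (p e : int) : set K :=
  [set x | exists u v : int, x = qel u%:~R v%:~R /\ (p %| u - e * v)%Z].

Lemma pideal_fractional (p e : int) :
  p != 0 -> (p %| e ^+ 2 + e - k)%Z -> fractional_ideal (pideal p e).
Proof.
move=> p_neq0 pe; split.
- exists (qel p%:~R 0%:~R); first by exists p, 0; rewrite mulr0 subr0.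
  by apply: contraNneq p_neq0 => /qel_eq0[/eqP + _]; rewrite intr_eq0.
- move=> _ _ [u [v [-> uv]]] [u' [v' [-> uv']]].
  exists (u + u'), (v + v'); split; first by rewrite qelD !rmorphD.
  have -> : u + u' - e * (v + v') = (u - e * v) + (u' - e * v') by ring.
  exact: rpredD.
- move=> a _ /ring_of_integersP[b [c ->]] [u [v [-> uv]]].
  exists (b * u + k * (c * v)), (b * v + u * c + c * v); split.
    by rewrite qelM; congr (qel _ _); ring.
  (* The map sending [w] to [- e], of which [pideal p e] is the kernel modulo [p], is multiplicative
     up to multiples of [e ^+ 2 + e - k]. *)
  have -> : b * u + k * (c * v) - e * (b * v + u * c + c * v) =
    (b - e * c) * (u - e * v) - c * v * (e ^+ 2 + e - k) by ring.
  by apply: rpredB; apply: dvdz_mull.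
exists 1; first by split; [exact: integral1|exact: oner_neq0].
by move=> _ [u [v [-> _]]]; rewrite mul1r; exact: qel_integral.
Qed.

(** Modulo [p], [u] is [e * v] and the norm becomes [v ^+ 2 * (e ^+ 2 + e - k)]. *)
Lemma dvdz_qnorm_pideal (p e u v : int) : (p %| e ^+ 2 + e - k)%Z ->
  (p %| u - e * v)%Z -> (p %| qnorm k u v)%Z.
Proof.
move=> pe uv; have -> : qnorm k u v =
    v ^+ 2 * (e ^+ 2 + e - k) + ((2 * e + 1) * v + (u - e * v)) * (u - e * v).
  by rewrite /qnorm intz; ring.
by apply: rpredD; apply: dvdz_mull.
Qed.

(* Together with [dvdz_qnorm_pideal], this says that the norms of the elements
   of [pideal p e] have gcd [p]. *)
Definition norm_content (p e : int) : Prop :=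
  exists u v : int, (p %| u - e * v)%Z /\ gcdz (p ^+ 2) (qnorm k u v) = p.

(** This compares ideal norms without defining them: the norm of the scaling factor times any norm
    from [pideal p e] is a multiple of [q], and the latter norms have gcd [p]. *)
Lemma scale_pideal_norm (p e q f : int) (c1 c2 : rat) :
  norm_content p e -> (q %| f ^+ 2 + f - k)%Z ->
  (scale_set (qel c1 c2) (pideal p e) `<=` pideal q f) ->
  exists j : int, qnorm k c1 c2 * p%:~R = (q * j)%:~R.
Proof.
move=> [u [v [uv gcd_p]]] qf sub.
have norm_dvd (a b : int) : (p %| a - e * b)%Z ->
    exists i : int, qnorm k c1 c2 * (qnorm k a b)%:~R = (q * i)%:~R.
  move=> ab; have /sub [a' [b' [abE ab']]] :
      scale_set (qel c1 c2) (pideal p e) (qel c1 c2 * qel a%:~R b%:~R).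
    by exists (qel a%:~R b%:~R) => //; exists a, b.
  have /dvdzP[i iE] := dvdz_qnorm_pideal qf ab'.
  exists i; rewrite [q * i]mulrC -iE -!qnorm_intr -qnormM.
  by move: abE; rewrite qelM => /qel_inj[-> ->].
have [i iE] := norm_dvd u v uv.
have [|i' i'E] := norm_dvd p 0; first by rewrite mulr0 subr0.
have {}i'E : qnorm k c1 c2 * (p ^+ 2)%:~R = (q * i')%:~R.
  by rewrite -i'E; congr (_ * _%:~R); rewrite /qnorm; ring.
(* [p] is an integral combination of the norms [p ^+ 2] and [qnorm k u v]. *)
have [x [y xyE]] := Bezoutz (p ^+ 2) (qnorm k u v).
exists (x * i' + y * i); rewrite -{1}gcd_p -xyE.
have -> : (q * (x * i' + y * i))%:~R = x%:~R * (q * i')%:~R + y%:~R * (q * i)%:~R :> rat.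
  by ring.
by rewrite -iE -i'E; ring.
Qed.

(** The scaling factor [c] and its inverse both satisfy [scale_pideal_norm]; multiplying the two
    equations shows that the cofactors [i] and [j] are units. *)
Lemma ideal_class_pideal_norm (p e q f : int) : 0 < p -> 0 < q ->
  (p %| e ^+ 2 + e - k)%Z -> (q %| f ^+ 2 + f - k)%Z ->
  norm_content p e -> norm_content q f ->
  ideal_class (pideal p e) = ideal_class (pideal q f) ->
  exists u v : int, `|qnorm k u v| = p * q.
Proof.
move=> p_gt0 q_gt0 pe qf p_cont q_cont /esym/ideal_class_eqP[c c_neq0 pE].
have [c1 [c2 cE]] := qelP c; have [d1 [d2 dE]] := qelP c^-1.
have qE : scale_set c^-1 (pideal p e) = pideal q f.
  rewrite pE /scale_set image_comp -[RHS]image_id; apply: eq_imagel => x _ /=.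
  by rewrite mulKf.
have [|j jE] := @scale_pideal_norm q f p e c1 c2 q_cont pe.
  by rewrite -cE -pE.
have [|i iE] := @scale_pideal_norm p e q f d1 d2 p_cont qf.
  by rewrite -dE qE.
have cd1 : qnorm k c1 c2 * qnorm k d1 d2 = 1.
  rewrite -qnormM; have := mulfV c_neq0; rewrite dE cE qelM.
  have -> : 1 = qel 1 0 by rewrite qel_rat rmorph1.
  by move=> /qel_inj[-> ->]; rewrite /qnorm; ring.
have ij1 : i * j = 1.
  have : (p * q * (i * j))%:~R = (p * q)%:~R :> rat.
    have -> : (p * q * (i * j))%:~R = (q * i)%:~R * (p * j)%:~R :> rat by ring.
    rewrite -iE -jE; transitivity ((p * q)%:~R * (qnorm k c1 c2 * qnorm k d1 d2)).
      by ring.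
    by rewrite cd1 mulr1.
  by move/intr_inj; rewrite -[RHS]mulr1; apply: mulfI; rewrite mulf_neq0 ?gt_eqF.
(* [c] has norm [+- p / q], so [c * q] has norm [+- p * q]. *)
have : pideal p e (c * qel q%:~R 0%:~R).
  rewrite pE; exists (qel q%:~R 0%:~R) => //.
  by exists q, 0; rewrite mulr0 subr0.
rewrite cE qelM => -[u [v [/qel_inj[uE vE] _]]].
have j1 : `|j| = 1.
  by move/(congr1 absz)/eqP: ij1; rewrite abszM muln_eq1 => /andP[_ /eqP]; lia.
exists u, v; suff -> : qnorm k u v = p * q * j.
  by rewrite normrM j1 mulr1 gtr0_norm // mulr_gt0.
apply: (@intr_inj rat); rewrite -qnorm_intr -uE -vE qnormM.
have -> : qnorm k (q%:~R : rat) 0%:~R = q%:~R * q%:~R by rewrite /qnorm; ring.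
by rewrite mulrA jE; ring.
Qed.

(** Only positivity is asked of the members of [s], so that 1 may occur; its ideal is the whole ring
    of integers. *)
Lemma class_number_ge_pideals (s : seq nat) (e : nat -> int) : uniq s ->
  (forall p, p \in s -> [/\ (0 < p)%N,
    (p %| e p ^+ 2 + e p - k)%Z & norm_content p (e p)]) ->
  (forall p q, p \in s -> q \in s -> p != q ->
    ~ exists u v : int, `|qnorm k u v| = p%:Z * q%:Z) ->
  (size s <= class_number K)%N.
Proof.
move=> s_uniq s_pideal no_norm.
rewrite -(size_map (fun p : nat => pideal p (e p))); apply: class_number_ge.
  move=> _ /mapP[p /s_pideal[p_gt0 pe _] ->]; apply: pideal_fractional => //.
  by rewrite eqz_nat -lt0n.
rewrite -map_comp map_inj_in_uniq // => p q ps qs /= eq_class; apply/eqP.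
apply: contraT => /(no_norm p q ps qs) [].
have [p_gt0 pe p_cont] := s_pideal p ps; have [q_gt0 qe q_cont] := s_pideal q qs.
exact: ideal_class_pideal_norm pe qe p_cont q_cont eq_class.
Qed.

End QuadraticOrder.

(** * Ramified primes, and the prime 3 when it splits *)

Lemma gcdz_sqr_prime (p : nat) (n : int) : prime p ->
  (p %| n)%Z -> ~~ (p%:Z ^+ 2 %| n)%Z -> gcdz (p%:Z ^+ 2) n = p.
Proof.
move=> p_pr /dvdzP[x ->]; rewrite expr2 dvdz_mul2r; last by rewrite eqz_nat -lt0n prime_gt0.
move=> px; rewrite /gcdz !abszM -muln_gcdl absz_nat.
by have /eqP-> : coprime p `|x|; rewrite ?mul1n // prime_coprime.
Qed.

Lemma norm_content1 (k e : int) : norm_content k 1 e.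
Proof. by exists 0, 0; rewrite dvd1z expr1n gcd1z. Qed.

(** For [e = p./2] one has [2 * e + 1 = p]; this [e] is the root modulo [p] when [p] divides the
    discriminant. *)
Lemma ramified_discriminant (k : int) (p : nat) : odd p ->
  4 * (p./2%:Z ^+ 2 + p./2%:Z - k) = p%:Z ^+ 2 - (4 * k + 1).
Proof.
move=> p_odd; have : p%:Z = 2 * p./2%:Z + 1.
  by rewrite -[in LHS](odd_double_half p) p_odd; lia.
by move: p%:Z p./2%:Z => P h ->; ring.
Qed.

Lemma ramified_root (k : int) (p : nat) : odd p -> (p %| 4 * k + 1)%Z ->
  (p %| p./2%:Z ^+ 2 + p./2%:Z - k)%Z.
Proof.
move=> p_odd pD; have co4 : coprimez p 4.
  by rewrite -[4]/(2 ^+ 2 : int); apply: coprimezXr; rewrite coprimezE /= coprimen2.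
rewrite -(Gauss_dvdzr _ co4) (ramified_discriminant k p_odd).
by apply: rpredB => //; apply: dvdz_mulr.
Qed.

(** The norm of [p./2 + w] is divisible by [p] only once, since otherwise [p ^+ 2] would divide the
    discriminant. *)
Lemma ramified_content (k : int) (p : nat) : squarefree (4 * k + 1) ->
  prime p -> odd p -> (p %| 4 * k + 1)%Z -> norm_content k p p./2%:Z.
Proof.
move=> D_sqf p_pr p_odd pD; exists p./2%:Z, 1; split; first by rewrite mulr1 subrr dvdz0.
have -> : qnorm k p./2%:Z 1 = p./2%:Z ^+ 2 + p./2%:Z - k by rewrite /qnorm intz; ring.
apply: gcdz_sqr_prime => //; first exact: ramified_root.
apply/negP => pp; have /D_sqf : (p%:Z ^+ 2 %| 4 * k + 1)%Z.
  have -> : 4 * k + 1 = p%:Z ^+ 2 - 4 * (p./2%:Z ^+ 2 + p./2%:Z - k).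
    by rewrite (ramified_discriminant k p_odd); ring.
  by apply: rpredB => //; apply: dvdz_mull.
by have := prime_gt1 p_pr; lia.
Qed.

Lemma split3_content (k : int) : (3 %| k)%Z -> norm_content k 3 0.
Proof.
move=> k3; pose u : int := if (9 %| k)%Z then 3 else 0.
have u3 : (3 %| u)%Z by rewrite /u; case: ifP.
(* The norm of [u + w] is [- k], or [12 - k] when 9 divides [k]; either way 3 divides it exactly
   once. *)
exists u, 1; split; first by rewrite mul0r subr0.
apply: (@gcdz_sqr_prime 3) => //.
  have -> : qnorm k u 1 = u * (u + 1) - k by rewrite /qnorm intz; ring.
  by apply: rpredB => //; apply: dvdz_mulr.
rewrite /qnorm intz /u; case: ifP => [|/negbT]; lia.
Qed.

(** * Bounds on products of prime divisors *)

Lemma exists_other_prime (n p q : nat) : (3 <= size (primes n))%N ->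
  exists2 r, r \in primes n & (r != p) && (r != q).
Proof.
move=> n3; apply/hasP/negPn; rewrite -all_predC; apply/negP => /allP all_pq.
suff : (size (primes n) <= size [:: p; q])%N by rewrite leqNgt n3.
apply: uniq_leq_size (primes_uniq n) _ => r /all_pq /=.
by rewrite negb_and !negbK !inE.
Qed.

(** A third prime divisor [r] is coprime to [p] and [q], so [p * q * r] divides [n]. *)
Lemma mul_lt_of_three_primes (n p q : nat) : (3 <= size (primes n))%N ->
  p \in 1%N :: primes n -> q \in 1%N :: primes n -> p != q -> (p * q < n)%N.
Proof.
move=> n3 pn qn neq_pq; have [r rn /andP[rp rq]] := exists_other_prime p q n3.
have n_gt0 : (0 < n)%N by move: rn; rewrite mem_primes => /and3P[].
have r_in : r \in 1%N :: primes n by rewrite inE rn orbT.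
have dvdn_in x : x \in 1%N :: primes n -> (x %| n)%N.
  by rewrite inE mem_primes => /orP[/eqP->|/and3P[]].
have co x y : x \in 1%N :: primes n -> y \in 1%N :: primes n -> x != y -> coprime x y.
  rewrite !inE !mem_primes => /orP[/eqP-> _ _|/and3P[x_pr _ _]]; first exact: coprime1n.
  case/orP=> [/eqP-> _|/and3P[y_pr _ _]]; first exact: coprimen1.
  by rewrite prime_coprime // dvdn_prime2.
have pqr : (p * q * r %| n)%N.
  by rewrite !Gauss_dvd ?coprimeMl ?co ?dvdn_in // eq_sym.
have r_gt1 : (1 < r)%N by move: rn; rewrite mem_primes => /and3P[/prime_gt1].
have pq_gt0 : (0 < p * q)%N.
  by case: (p * q)%N pqr => //; rewrite mul0n dvd0n => /eqP n0; rewrite n0 in n_gt0.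
by apply: leq_trans (dvdn_leq n_gt0 pqr); rewrite ltn_Pmulr.
Qed.

(** Another prime divisor [r] of [n] is odd, hence at least 3, and [p * r < n]. *)
Lemma mul3_lt_of_three_primes (n p : nat) : (3 <= size (primes n))%N -> odd n ->
  ~~ (3 %| n)%N -> p \in 1%N :: primes n -> (p * 3 < n)%N.
Proof.
move=> n3 n_odd n_ndiv3 pn; have [r rn /andP[rp _]] := exists_other_prime p p n3.
have : r \in 1%N :: primes n by rewrite inE rn orbT.
move=> /(mul_lt_of_three_primes n3 pn)-/(_ (_ : p != r)); rewrite eq_sym => /(_ rp).
apply: leq_ltn_trans; rewrite leq_mul2l; apply/orP; right.
move: rn; rewrite mem_primes => /and3P[r_pr _ rn].
by have := dvdn_odd rn n_odd; case: r r_pr {rp rn} => [|[|[|]]].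
Qed.

(** Take [w = (1 + s) / 2]. Since [s ^+ 2] is rational, every polynomial in [s] reduces to some
    [a + b * s = (a - b) + 2 * b * w]. *)
Lemma quadratic_coordinates (k : int) (K : fieldExtType rat) (s : K) :
  s ^+ 2 = (4 * k + 1)%:~R -> <<1; s>>%VS = {:K}%VS ->
  exists w : K, w ^+ 2 = w + k%:~R /\
    forall x : K, exists a b : rat, x = a%:A + b%:A * w.
Proof.
move=> s2 s_gen.
have two_neq0 : 2 != 0 :> K by rewrite -(rmorph_nat (in_alg K)) fmorph_eq0.
exists ((1 + s) / 2); split.
  have -> : ((1 + s) / 2) ^+ 2 = (1 + 2 * s + s ^+ 2) / 4.
    by field; rewrite -[4]/(2 * 2)%:R natrM mulf_neq0.
  rewrite s2 rmorphD rmorphM /=; field.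
  by rewrite two_neq0 -[4]/(2 * 2)%:R natrM mulf_neq0.
move=> x; have : x \in <<1; s>>%VS by rewrite s_gen memvf.
case/Fadjoin1_polyP => p ->{x}.
suff [a [b ->]] : exists a b : rat, (map_poly (in_alg K) p).[s] = in_alg K a + in_alg K b * s.
  exists (a - b), (2 * b); rewrite -!in_algE rmorphB rmorphM rmorph_nat; field.
  exact: two_neq0.
elim/poly_ind: p => [|p c [a [b IH]]].
  by exists 0, 0; rewrite rmorph0 horner0 rmorph0 mul0r addr0.
exists (b * (4 * k + 1)%:~R + c), a.
rewrite rmorphD rmorphM /= map_polyX map_polyC !hornerE IH.
rewrite -!in_algE rmorphD rmorphM rmorph_int -s2.
ring.
Qed.

(** * The list of ideals attached to [m], and its length *)

Theorem theorem1p3 (m D : int) (K : fieldExtType rat)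
    (m_odd : odd `|m|%N)
    (m_primes : (3 <= size (primes `|m|%N))%N)
    (D_def : D = 9 * m ^+ 2 + 4 * m)
    (D_sqfree : squarefree D)
    (K_def : is_real_quadratic_field D K) :
  let N := count (fun p => (3 < p)%N) (primes `|m|%N) in
  ((if (m == 2 %[mod 3])%Z then 1 + N else 2 + N) <= class_number K)%N.
Proof.
lazy zeta; set N := count _ _; have [D_gt0 [_ D_neq1 [s s2 s_gen]]] := K_def.
have [j mE] : exists j, m = 2 * j + 1.
  by exists ((m - 1) %/ 2)%Z; lia.
pose k := 9 * j ^+ 2 + 11 * j + 3.
have DE : D = 4 * k + 1 by rewrite D_def mE /k; ring.
rewrite DE in D_gt0 D_neq1 s2 D_sqfree.
have [w [w_sqr w_span]] := quadratic_coordinates s2 s_gen.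
pose n := `|m|%N; have n_gt0 : (0 < n)%N.
  by rewrite lt0n; apply: contraTneq m_odd; rewrite -/n => ->.
pose split3 := (m == 1 %[mod 3])%Z.
have k3 : split3 -> (3 %| k)%Z.
  rewrite /split3 mE => j1.
  have /dvdzP[i iE] : (3 %| j)%Z by lia.
  by rewrite /k iE; apply/dvdzP; exists (27 * i ^+ 2 + 11 * i + 1); ring.
(* The entry 1 stands for the unit ideal; 3 is appended only when [m] is 1 modulo 3, so it is not
   already among the primes of [n]. *)
pose S := 1%N :: primes n ++ (if split3 then [:: 3%N] else [::]).
pose e p : int := if split3 && (p == 3%N) then 0 else p./2%:Z.
have p_odd p : p \in primes n -> odd p.
  by rewrite mem_primes => /and3P[_ _ /dvdn_odd]; apply.
have three_notin : split3 -> (3%N \in primes n) = false.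
  by move=> m1; rewrite mem_primes n_gt0 /=; apply/negP => n3; rewrite /split3 /n in m1 n3; lia.
have pD p : p \in primes n -> (p %| 4 * k + 1)%Z.
  rewrite mem_primes => /and3P[_ _ pn]; rewrite -DE D_def.
  have -> : 9 * m ^+ 2 + 4 * m = m * (9 * m + 4) by ring.
  exact: dvdz_mulr.
have S_cases p : p \in S -> p \in 1%N :: primes n \/ split3 /\ p = 3%N.
  rewrite /S -cat_cons mem_cat => /orP[|]; first by left.
  by case: ifP => // m1; rewrite inE => /eqP; right.
have S_prime p : p \in S -> (p == 1%N) || prime p.
  case/S_cases => [|[_ ->]] //; rewrite inE mem_primes.
  by case/orP => [->//|/and3P[-> _ _]]; rewrite orbT.
have mul_lt_n p q : p \in S -> q \in S -> p != q -> (p * q < n)%N.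
  have three_ndvd : split3 -> ~~ (3 %| n)%N.
    by move=> /three_notin; rewrite mem_primes n_gt0 /= => ->.
  move=> /S_cases[pn|[m1 ->]] /S_cases[qn|[m1' ->]] //.
  - exact: mul_lt_of_three_primes.
  - by move=> _; apply: mul3_lt_of_three_primes => //; exact: three_ndvd.
  by move=> _; rewrite mulnC; apply: mul3_lt_of_three_primes => //; exact: three_ndvd.
apply: leq_trans (_ : size S <= _)%N; last first.
  apply: (class_number_ge_pideals w_sqr w_span D_sqfree D_neq1 D_gt0 (e := e)).
  - rewrite /S /= mem_cat cat_uniq primes_uniq mem_primes /=.
    by case: ifP => //= m1; rewrite orbF three_notin.
  - move=> p pS; rewrite /e; have [/andP[m1 /eqP->]|not_split] := ifP.
      split=> //; first by rewrite expr0n /= !add0r rpredN k3.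
      by apply: split3_content; exact: k3.
    have [|[m1 p3]] := S_cases p pS; last by rewrite m1 p3 in not_split.
    rewrite inE => /orP[/eqP->|pn].
      by split; [|exact: dvd1z|exact: norm_content1].
    have p_pr : prime p by move: pn; rewrite mem_primes => /and3P[].
    split; first exact: prime_gt0.
      exact: ramified_root (p_odd p pn) (pD p pn).
    exact: ramified_content (p_odd p pn) (pD p pn).
  move=> p q pS qS neq_pq [u [v uv]]; have lt_n := mul_lt_n p q pS qS neq_pq.
  (* Here [2 * h + 3] is the absolute value of [9 * m + 2]. Thus [2 * h + 1] is [9 * n] for positive
     [m] and [9 * n - 4] for negative [m], enough since [p * q <= n - 1]. *)
  have [h [h_gt0 hk h_small]] : exists h : int,
      [/\ 0 < h, h ^+ 2 + 3 * h - 9 * k = 1 & 9 * n%:Z - 4 <= 2 * h + 1].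
    have [j0|j0] := lerP 0 j.
      by exists (9 * j + 4); split; [lia|rewrite /k; ring|rewrite /n; lia].
    by exists (- 9 * j - 7); split; [lia|rewrite /k; ring|rewrite /n; lia].
  have [||r rE] := small_norm_square h_gt0 hk (u := u) (v := v) (n := qnorm k u v).
  - by rewrite /qnorm intz.
  - by rewrite uv -PoszM; lia.
  have {}rE : (p * q = r ^ 2)%N by rewrite -rE; lia.
  have [p1|p_neq1] := eqVneq p 1%N; last first.
    have p_pr : prime p by have := S_prime p pS; rewrite (negPf p_neq1).
    apply: (nonsquare_mul_primes p_pr (S_prime q qS)); first by rewrite eq_sym.
    by exists r; rewrite mulnC.
  have q_pr : prime q.
    by have := S_prime q qS; rewrite -p1 eq_sym (negPf neq_pq).
  by apply: (nonsquare_mul_primes q_pr (S_prime p pS) neq_pq); exists r.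
have le_size : (N <= size (primes n))%N by exact: count_size.
rewrite /S /= size_cat; case: ifP => [_|m2].
  by rewrite add1n ltnS (leq_trans le_size) ?leq_addr.
case: ifP => [_|m1]; first by rewrite /= addn1 add2n !ltnS.
(* Now 3 divides [m]: this prime belongs to [S] but is not counted by [N], which supplies the extra
   1. *)
have three_in : 3%N \in primes n.
  by rewrite mem_primes n_gt0 /=; move: m1 m2; rewrite /split3 /n; lia.
rewrite addn0 add2n ltnS /N -(count_predC (fun p => (3 < p)%N)) -addn1 leq_add2l.
by rewrite -has_count; apply/hasP; exists 3%N.
Qed.
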